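(* Let $p$ be a prime, let $\mathbb{F}$ be a perfect field of characteristic $p$, let $m$ be a positive integer, and let $A=\bigoplus_{k\in\mathbb{Z}/m\mathbb{Z}}A_k$ be a nonassociative algebra over $\mathbb{F}$, graded over the integers modulo $m$. Suppose that $A$ has a graded derivation $D$ of degree $d$, with $m\mid pd$, such that $D^{p^r}$ is diagonalizable over $\mathbb{F}$, where $r\ge 1$ is an integer. Suppose that there exists a $p$-polynomial $g(T)\in\mathbb{F}[T]$ such that $g(D)^p-g(D)=D^{p^r}$. Set $h(T)=\sum_{i=1}^{r-1}T^{p^i}\in\mathbb{F}_p[T]$. Let $A=\bigoplus_{\rho\in\mathbb{F}}A^{(\rho)}$ be the decomposition of $A$ into a direct sum of generalized eigenspaces for $D$ (with $A^{(\rho)}$ corresponding to the eigenvalue $\rho$). Let $\mathcal{L}_D:A\to A$ be the linear map whose restriction to $A^{(\rho)}$ coincides with $L_{p-1}^{(g(\rho)-h(D))}(D)$, for each $\rho$. Then $A=\bigoplus_{k}\mathcal{L}_D(A_k)$ is also a grading of $A$ over the integers modulo $m$.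
   Context: A nonassociative algebra over $\mathbb{F}$ is an $\mathbb{F}$-vector space $A$ (of arbitrary dimension) with a bilinear multiplication, not necessarily associative (nor unital or commutative). A grading of $A$ over the integers modulo $m$ is a direct sum decomposition $A=\bigoplus_{k\in\mathbb{Z}/m\mathbb{Z}}A_k$ into subspaces such that $A_kA_\ell\subseteq A_{k+\ell}$ for all $k,\ell$. A derivation of $A$ is a linear map $D:A\to A$ with $D(xy)=(Dx)y+x(Dy)$ for all $x,y\in A$; it is graded of degree $d$ ($d$ an integer, read modulo $m$ in subscripts) if $D(A_k)\subseteq A_{k+d}$ for all $k$. The generalized eigenspace of $D$ for $\rho$ is $A^{(\rho)}=\{x\in A: (D-\rho\,\mathrm{id})^n x=0 \text{ for some } n\ge 1\}$. A $p$-polynomial is a polynomial of the form $\sum_i b_iT^{p^i}$ (a finite linear combination of monomials $T^{p^i}$, $i\ge 0$). The (generalized) Laguerre polynomial of degree $n$ is $L_n^{(\alpha)}(X)=\sum_{k=0}^n\binom{\alpha+n}{n-k}\frac{(-X)^k}{k!}$, viewed as a polynomial in the two indeterminates $\alpha$ and $X$ with rational coefficients. For $n=p-1$ the coefficients have denominators prime to $p$, and $L_{p-1}^{(\alpha)}(X)$ is viewed, by reduction modulo $p$, as an element of $\mathbb{F}_p[\alpha,X]$. The expression $L_{p-1}^{(g(\rho)-h(D))}(D)$ is the linear operator obtained by substituting $\alpha=g(\rho)\,\mathrm{id}-h(D)$ and $X=D$ (commuting operators) in this two-variable polynomial. *)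

(* Defs.v *)
From HB Require Import structures.
From mathcomp Require Import all_boot all_order all_algebra.
From mathcomp Require Import finmap.
From mathcomp Require Import boolp classical_sets.

Set Implicit Arguments.
Unset Strict Implicit.
Unset Printing Implicit Defensive.

Import GRing.Theory.

Local Open Scope classical_set_scope.
Local Open Scope ring_scope.

Definition perfect_of_char (p : nat) (F : fieldType) : Prop :=
  p \in [pchar F] /\ forall x : F, exists y : F, y ^+ p = x.

Section DirectSum.
Variables (F : fieldType) (A : lmodType F).

(* The index type may be infinite, so decompositions are finitely supported. *)
Definition is_direct_sum (I : choiceType) (V : I -> set A) : Prop :=
  (forall i, GRing.submod_closed (mem (V i))) /\
  forall x : A, exists! f : {fsfun I -> A with 0},
    (forall i, V i (f i)) /\ x = \sum_(i <- finsupp f) f i.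

Definition eigenspace_of (T : A -> A) (rho : F) : set A :=
  [set x | T x = rho *: x].

Definition gen_eigenspace (T : A -> A) (rho : F) : set A :=
  [set x | exists2 n, (0 < n)%N & iter n (fun y => T y - rho *: y) x = 0].

Definition diagonalizable_op (T : A -> A) : Prop :=
  is_direct_sum (eigenspace_of T).

End DirectSum.

Section GradedAlgebra.
Variables (F : fieldType) (A : lmodType F) (mul : {bilinear A -> A -> A}).

(* For 0 < m, the elements of Z/mZ are represented by 'I_m; the representative
   of a class is designated by a congruence, because 'Z_m is not Z/mZ when m
   is 1. *)
Definition is_grading (m : nat) (G : 'I_m -> set A) : Prop :=
  is_direct_sum G /\
  forall i j k : 'I_m, (k = i + j %[mod m])%N ->
    forall x y, G i x -> G j y -> G k (mul x y).

Definition is_derivation (D : A -> A) : Prop :=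
  forall x y, D (mul x y) = mul (D x) y + mul x (D y).

Definition graded_of_degree (m : nat) (G : 'I_m -> set A) (d : int)
    (D : A -> A) : Prop :=
  forall i j : 'I_m, (j%:Z = i%:Z + d %[mod m])%Z -> forall x, G i x -> G j (D x).

End GradedAlgebra.

Definition p_polynomial (F : fieldType) (p : nat) (q : {poly F}) : Prop :=
  exists (n : nat) (b : nat -> F), q = \sum_(i < n) b i *: 'X^(p ^ i).

Section Substitution.
Variables (F : fieldType) (A : lmodType F).

Definition poly_op (q : {poly F}) (T : A -> A) (x : A) : A :=
  \sum_(i < size q) q`_i *: iter i T x.

(* The outer variable of q is replaced by T and the inner one by S. *)
Definition poly2_op (q : {poly {poly F}}) (S T : A -> A) (x : A) : A :=
  \sum_(k < size q) poly_op q`_k S (iter k T x).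

End Substitution.

(* The binomial coefficient "a choose j" for a polynomial a. *)
Definition binomial_poly (a : {poly rat}) (j : nat) : {poly rat} :=
  (j`!%:R)^-1 *: \prod_(i < j) (a - i%:R).

(* In {poly {poly rat}}, the inner variable is alpha and the outer one is X. *)
Definition laguerre (n : nat) : {poly {poly rat}} :=
  \sum_(k < n.+1)
    ((k`!%:R)^-1 *: binomial_poly ('X + n%:R) (n - k))%:P * (- 'X) ^+ k.

(* For p in [pchar F], ratr sends a rational whose denominator is prime to p
   to its reduction modulo p, in the prime subfield of F. *)
Definition laguerre_mod (F : fieldType) (n : nat) : {poly {poly F}} :=
  map_poly (map_poly (ratr : rat -> F)) (laguerre n).

Definition laguerre_op (F : fieldType) (A : lmodType F) (n : nat)
    (S T : A -> A) : A -> A :=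
  poly2_op (laguerre_mod F n) S T.

(* Main.v *)
Require Import Defs.
From HB Require Import structures.
From mathcomp Require Import all_boot all_order all_algebra.
From mathcomp Require Import finmap.
From mathcomp Require Import boolp classical_sets.
From mathcomp Require Import ring.

(** Write q = p^r. Since D^q is diagonalizable and (D - rho)^q = D^q - rho^q, the
    generalized eigenspace of D for rho is the eigenspace of D^q for rho^q
    (gen_eigenspaceE); as F is perfect, these exhaust the eigenspaces of D^q, so
    they decompose A. On a nonzero one the hypothesis on g yields
    g(rho)^p - g(rho) = rho^q, and then alpha = g(rho) - h(X) satisfies
    X^p - (alpha^p - alpha) = X^q - rho^q (laguerre_paramXp).

    The Laguerre polynomial L of degree p - 1 satisfies in characteristic p the
    differential equation X L' = (X - alpha) L + X^p - (alpha^p - alpha) for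
    every alpha with zero derivative (laguerre_sub_ode), like X^(-alpha) exp X up
    to the term X^p - (alpha^p - alpha). Two consequences carry the proof.

    First, the value at X = rho of the Laguerre polynomial with parameter
    g(rho) - h(X) is not 0 (laguerre_param_neq0), hence that polynomial is
    invertible modulo X^q - rho^q = (X - rho)^q, and the map LD is bijective.

    Secondly, let l1, l2 and s be the Laguerre polynomials in X, in Y and in
    X + Y attached to rho, sigma and rho + sigma. As g and h are additive, the
    parameter of s is the sum of those of l1 and l2, and the Euler derivation
    E = X d/dX + Y d/dY multiplies both l1 l2 and s by the same factor, modulo the
    ideal I generated by X^q - rho^q and Y^q - sigma^q. So E annihilates the
    quotient C = l1 l2 / s modulo I, and C may be taken with all its monomials of
    total degree divisible by p (laguerre_sub_switch). Let X and Y act on the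
    product of x and y, in the generalized eigenspaces for rho and sigma, as D on
    the first and on the second factor. Then X + Y acts as D on the product, and I
    annihilates it, so that LD x times LD y is the image under LD of the action
    of C on the product of x and y. The operator C has degree 0 because
    m divides p d (monomial_degree). Finally D^q has degree 0, so that homogeneous
    elements are sums of homogeneous elements in the generalized eigenspaces. *)

Set Implicit Arguments.
Unset Strict Implicit.
Unset Printing Implicit Defensive.

Import GRing.Theory Num.Theory.

Local Open Scope classical_set_scope.
Local Open Scope ring_scope.

(** * Direct sums indexed by an arbitrary set *)

Section DirectSums.
Variables (F : fieldType) (A : lmodType F).

Lemma submod_closedP (V : set A) :
  GRing.submod_closed (mem V) <->
  V 0 /\ forall a x y, V x -> V y -> V (a *: x + y).
Proof.
split=> -[V0 VD]; split.
- by move: V0; rewrite inE.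
- by move=> a x y Vx Vy; have := VD a x y; rewrite !inE; apply.
- by rewrite inE.
- by move=> a x y; rewrite !inE; apply: VD.
Qed.

Lemma submod_sum (V : set A) (I : Type) (s : seq I) (f : I -> A) :
  GRing.submod_closed (mem V) -> (forall i, V (f i)) -> V (\sum_(i <- s) f i).
Proof.
move=> /submod_closedP[V0 VD] Vf; elim/big_ind: _ => // x y Vx Vy.
by rewrite -[x]scale1r; apply: VD.
Qed.

(** The sum of the V i is the whole space. *)
Definition spans (I : choiceType) (V : I -> set A) : Prop :=
  forall x, exists (s : seq I) (f : I -> A),
    [/\ uniq s, forall i, V i (f i) & x = \sum_(i <- s) f i].

(** The sum of the V i is direct. *)
Definition independent (I : choiceType) (V : I -> set A) : Prop :=
  forall (s : seq I) (f : I -> A), uniq s -> (forall i, V i (f i)) ->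
    \sum_(i <- s) f i = 0 -> forall i, i \in s -> f i = 0.

Lemma sum_finsupp (I : choiceType) (f : {fsfun I -> A with 0}) (s : seq I)
    (B : lmodType F) (phi : I -> A -> B) :
  (forall i, phi i 0 = 0) ->
  uniq s -> {subset finsupp f <= s} ->
  \sum_(i <- s) phi i (f i) = \sum_(i <- finsupp f) phi i (f i).
Proof.
move=> phi0 s_uniq sub; rewrite (bigID (mem (finsupp f))) /=.
rewrite [X in _ + X]big1 ?addr0; last first.
  by move=> i; rewrite memNfinsupp => /eqP->.
rewrite -big_filter; apply: perm_big; apply: uniq_perm.
- exact: filter_uniq.
- exact: fset_uniq.
move=> i; rewrite mem_filter.
by case: (boolP (i \in finsupp f)) => //= /sub ->.
Qed.

Lemma fsfun_of_family (I : choiceType) (V : I -> set A) (s : seq I) (f : I -> A) :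
  uniq s -> (forall i, V i 0) -> (forall i, V i (f i)) ->
  exists f' : {fsfun I -> A with 0},
    [/\ {in s, f' =1 f}, forall i, V i (f' i) &
        \sum_(i <- finsupp f') f' i = \sum_(i <- s) f i].
Proof.
move=> s_uniq V0 Vf.
pose f' := [fsfun i in [fset i | i in s]%fset => f i | 0] : {fsfun I -> A with 0}.
have f'E i : f' i = if i \in s then f i else 0 by rewrite fsfunE !inE.
exists f'; split=> [i iS|i|]; rewrite ?f'E ?iS //; first by case: ifP.
rewrite -(sum_finsupp (phi := fun=> id) (f := f') _ s_uniq) //.
  by rewrite !big_seq; apply: eq_bigr => i iS; rewrite f'E iS.
by move=> i; rewrite mem_finsupp f'E; case: ifP; rewrite ?eqxx.
Qed.

(** Existence of the finitely supported decomposition means spanning, and its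
    uniqueness means independence. *)
Lemma is_direct_sumP (I : choiceType) (V : I -> set A) :
  is_direct_sum V <->
  [/\ forall i, GRing.submod_closed (mem (V i)), spans V & independent V].
Proof.
split=> [[Vsub dec]|[Vsub Vspan Vind]].
- have V0 i : V i 0 by have /submod_closedP[] := Vsub i.
  split=> // [x|s f s_uniq Vf sum0 i iS].
    have [f [[Vf ->] _]] := dec x.
    by exists (finsupp f), f; split => //; apply: fset_uniq.
  have [f' [f'E Vf' f'sum]] := fsfun_of_family s_uniq V0 Vf.
  have [f0 [_ f0_uniq]] := dec 0.
  rewrite -f'E // -(f0_uniq f'); last by split=> //; rewrite f'sum sum0.
  rewrite (f0_uniq [fsfun]) ?fsfun0E //.
  by split=> [j|]; rewrite ?fsfun0E // finsupp0 big_seq_fset0.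
split=> // x.
have [s [f [s_uniq Vf xE]]] := Vspan x.
have V0 i : V i 0 by have /submod_closedP[] := Vsub i.
have [f1 [_ Vf1 f1sum]] := fsfun_of_family s_uniq V0 Vf.
exists f1; split=> [|f2 [Vf2 xE2]]; first by rewrite f1sum.
pose S := (finsupp f1 `|` finsupp f2)%fset.
have S_uniq : uniq S := fset_uniq _.
have [sub1 sub2] : {subset finsupp f1 <= S} /\ {subset finsupp f2 <= S}.
  by split=> i; rewrite inE => ->; rewrite ?orbT.
have : \sum_(i <- S) (f1 i - f2 i) = 0.
  rewrite big_split /= sumrN.
  rewrite (sum_finsupp (phi := fun=> id) _ S_uniq sub1) //.
  rewrite (sum_finsupp (phi := fun=> id) _ S_uniq sub2) //.
  by rewrite f1sum -xE -xE2 subrr.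
move=> dif0; apply/fsfunP => i; case: (boolP (i \in S)) => [iS|].
  apply/eqP; rewrite -subr_eq0; apply/eqP.
  apply: (Vind S (fun i => f1 i - f2 i)) => // j.
  have /submod_closedP[_ VD] := Vsub j.
  by rewrite addrC -scaleN1r; apply: VD.
by rewrite inE negb_or !memNfinsupp => /andP[/eqP-> /eqP->].
Qed.

(** A linear map may be prescribed summand by summand. *)
Lemma direct_sum_extend (I : choiceType) (V : I -> set A) (B : lmodType F)
    (phi : I -> {linear A -> B}) :
  is_direct_sum V ->
  exists Phi : {linear A -> B}, forall i x, V i x -> Phi x = phi i x.
Proof.
move=> dirV; have [Vsub _ Vind] := (is_direct_sumP V).1 dirV.
have [_ dec] := dirV.
(* c x i is the component of x in V i; it is linear in x by independence. *)
have /choice[c cP] : forall x, exists f : {fsfun I -> A with 0},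
    (forall i, V i (f i)) /\ x = \sum_(i <- finsupp f) f i.
  by move=> x; have [f [fP _]] := dec x; exists f.
have cV x i : V i (c x i) by have [] := cP x.
have csum (s : seq I) x : uniq s -> {subset finsupp (c x) <= s} ->
    \sum_(i <- s) c x i = x.
  move=> s_uniq sub; rewrite (sum_finsupp (phi := fun=> id) _ s_uniq sub) //.
  by have [_ <-] := cP x.
have VL i a x y : V i x -> V i y -> V i (a *: x + y).
  by have /submod_closedP[_] := Vsub i; apply.
pose S (a : F) (x y : A) :=
  (finsupp (c (a *: x + y)%R) `|` (finsupp (c x) `|` finsupp (c y)))%fset.
have S_uniq a (x y : A) : uniq (S a x y) := fset_uniq _.
have S_sub1 a (x y : A) : {subset finsupp (c (a *: x + y)) <= S a x y}.
  by move=> i iS; rewrite !inE iS.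
have S_sub2 a (x y : A) : {subset finsupp (c x) <= S a x y}.
  by move=> i iS; rewrite !inE iS !orbT.
have S_sub3 a (x y : A) : {subset finsupp (c y) <= S a x y}.
  by move=> i iS; rewrite !inE iS !orbT.
have cL a (x y : A) i : c (a *: x + y) i = a *: c x i + c y i.
  apply/eqP; rewrite -subr_eq0; apply/eqP.
  case: (boolP (i \in S a x y)) => [iS|]; last first.
    by rewrite !inE !negb_or !memNfinsupp => /and3P[/eqP-> /eqP-> /eqP->];
       rewrite scaler0 addr0 subrr.
  apply: (Vind (S a x y) (fun i => c (a *: x + y) i - (a *: c x i + c y i))) => //.
    by move=> j; rewrite addrC -scaleN1r; apply: (VL) => //; apply: VL.
  rewrite big_split sumrN big_split -scaler_sumr /=.
  rewrite (csum _ _ _ (@S_sub1 a x y)) // (csum _ _ _ (@S_sub2 a x y)) //.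
  by rewrite (csum _ _ _ (@S_sub3 a x y)) // subrr.
pose Phi x := \sum_(i <- finsupp (c x)) phi i (c x i).
have PhiE (s : seq I) x : uniq s -> {subset finsupp (c x) <= s} ->
    Phi x = \sum_(i <- s) phi i (c x i).
  move=> s_uniq sub; rewrite (sum_finsupp (phi := phi) _ s_uniq sub) // => i.
  by rewrite linear0.
have Phi_lin : linear Phi.
  move=> a x y.
  rewrite (PhiE (S a x y) _ _ (@S_sub1 a x y)) //.
  rewrite (PhiE (S a x y) x _ (@S_sub2 a x y)) //.
  rewrite (PhiE (S a x y) y _ (@S_sub3 a x y)) // scaler_sumr -big_split.
  by apply: eq_bigr => i _; rewrite cL linearP.
pose P : {linear A -> B} :=
  HB.pack Phi (GRing.isLinear.Build F A B *:%R Phi Phi_lin).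
exists P => i x Vx; rewrite /P /= /Phi.
(* c x is the one-term family with value x at i, by independence. *)
have c0 j : c x j = if j == i then x else 0.
  pose s := undup (i :: finsupp (c x)).
  have s_uniq : uniq s by apply: undup_uniq.
  have sub : {subset i :: finsupp (c x) <= s} by move=> k; rewrite mem_undup.
  apply/eqP; rewrite -subr_eq0; apply/eqP; case: (boolP (j \in s)) => [js|].
    apply: (Vind s (fun j => c x j - if j == i then x else 0)) => //.
      move=> k; rewrite addrC -scaleN1r; apply: VL => //; case: eqP => [->//|_].
      by have /submod_closedP[] := Vsub k.
    rewrite big_split sumrN /= csum // => [|k ks]; last first.
      by rewrite sub // inE ks orbT.
    rewrite -big_mkcond /= -big_filter filter_pred1_uniq ?sub ?mem_head //.
    by rewrite big_seq1 subrr.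
  rewrite mem_undup inE negb_or memNfinsupp => /andP[/negPf-> /eqP->].
  by rewrite subrr.
have sub : {subset finsupp (c x) <= [:: i]}.
  by move=> j; rewrite mem_finsupp c0 inE; case: (j == i); rewrite ?eqxx.
by rewrite -[LHS]/(Phi x) (PhiE [:: i]) // big_seq1 c0 eqxx.
Qed.
End DirectSums.

(** * Polynomials in a linear operator *)

Section PolyOp.
Variables (F : fieldType) (A : lmodType F) (D : {linear A -> A}).
Implicit Types (u v q : {poly F}) (x : A).

Lemma iter_is_linear n : linear (iter n D).
Proof.
by elim: n => [//|n IH] a x y; rewrite !iterS IH linearP.
Qed.
HB.instance Definition _ n :=
  GRing.isLinear.Build F A A *:%R (iter n D) (iter_is_linear n).

Lemma poly_op_wide n q x : (size q <= n)%N ->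
  poly_op q D x = \sum_(i < n) q`_i *: iter i D x.
Proof.
move=> le_qn; rewrite /poly_op.
rewrite (big_ord_widen _ (fun i => q`_i *: iter i D x) le_qn).
rewrite big_mkcond; apply: eq_bigr => i _; case: ltnP => // /leq_sizeP->//.
by rewrite scale0r.
Qed.

Lemma poly_opDl u v x : poly_op (u + v) D x = poly_op u D x + poly_op v D x.
Proof.
pose n := maxn (size (u + v)) (maxn (size u) (size v)).
rewrite (@poly_op_wide n) ?leq_maxl // (@poly_op_wide n u) ?(@poly_op_wide n v).
- by rewrite -big_split; apply: eq_bigr => i _; rewrite coefD scalerDl.
- by rewrite /n !leq_max leqnn !orbT.
- by rewrite /n !leq_max leqnn !orbT.
Qed.

Lemma poly_opC c x : poly_op c%:P D x = c *: x.
Proof.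
by rewrite (@poly_op_wide 1) ?size_polyC ?leq_b1 // big_ord1 coefC.
Qed.

Lemma poly_opMX u x : poly_op (u * 'X) D x = poly_op u D (D x).
Proof.
rewrite (@poly_op_wide (size u).+1); last first.
  by rewrite (leq_trans (size_polyMleq _ _)) // size_polyX addn2.
rewrite big_ord_recl coefMX scale0r add0r /poly_op; apply: eq_bigr => i _.
by rewrite coefMX lift0 -iterSr.
Qed.

Lemma poly_op_is_linear q : linear (poly_op q D).
Proof.
move=> a x y; rewrite scaler_sumr -big_split; apply: eq_bigr => i _ /=.
by rewrite linearP scalerDr !scalerA mulrC.
Qed.
HB.instance Definition _ q :=
  GRing.isLinear.Build F A A *:%R (poly_op q D) (poly_op_is_linear q).

Lemma poly_op0 x : poly_op 0 D x = 0.
Proof. by rewrite -[0]/(0%:P) poly_opC scale0r. Qed.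

Lemma poly_opZl c u x : poly_op (c *: u) D x = c *: poly_op u D x.
Proof.
rewrite (@poly_op_wide (size u)) ?size_scale_leq // scaler_sumr.
by apply: eq_bigr => i _; rewrite coefZ scalerA.
Qed.

Lemma poly_opBl u v x : poly_op (u - v) D x = poly_op u D x - poly_op v D x.
Proof. by rewrite poly_opDl -(scaleN1r v) poly_opZl scaleN1r. Qed.

Lemma poly_opM u v x : poly_op (u * v) D x = poly_op u D (poly_op v D x).
Proof.
rewrite mulrC; elim/poly_ind: v x => [|v c IH] x.
  by rewrite mul0r !poly_op0 linear0.
rewrite mulrDl mulrAC !poly_opDl !poly_opMX poly_opC linearD IH linearZ /=.
by rewrite mul_polyC poly_opZl.
Qed.

Lemma poly_opX x : poly_op 'X D x = D x.
Proof. by rewrite -['X]mul1r poly_opMX poly_opC scale1r. Qed.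

Lemma poly_opXn n x : poly_op 'X^n D x = iter n D x.
Proof.
elim: n x => [|n IH] x; first by rewrite expr0 poly_opC scale1r.
by rewrite exprSr poly_opMX IH -iterSr.
Qed.

Lemma poly_op_exp n u x : poly_op (u ^+ n) D x = iter n (poly_op u D) x.
Proof.
elim: n => [|n IH]; first by rewrite expr0 poly_opC scale1r.
by rewrite exprS poly_opM IH.
Qed.

Lemma poly_op_comm u v x :
  poly_op u D (poly_op v D x) = poly_op v D (poly_op u D x).
Proof. by rewrite -!poly_opM mulrC. Qed.

End PolyOp.

Section PolyOpComposition.
Variables (F : fieldType) (A : lmodType F) (D : {linear A -> A}).

Lemma poly_op_comp u v x : poly_op u (poly_op v D) x = poly_op (u \Po v) D x.
Proof.
elim/poly_ind: u x => [|u c IH] x.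
  by rewrite comp_poly0 !poly_op0.
rewrite comp_poly_MXaddC !poly_opDl !poly_opMX !poly_opC IH.
by rewrite poly_opM.
Qed.

(** Substituting the operators v(D) and D in a polynomial in two variables
    amounts to substituting D in a polynomial in one variable. *)
Lemma poly2_opE (L : {poly {poly F}}) v x :
  poly2_op L (poly_op v D) D x =
  poly_op (\sum_(k < size L) (L`_k \Po v) * 'X^k) D x.
Proof.
rewrite /poly2_op.
elim/big_rec2: _ => [|k y u _ ->]; first by rewrite poly_op0.
by rewrite poly_opDl poly_opM poly_opXn poly_op_comp.
Qed.
End PolyOpComposition.

Lemma poly_op_coprime0 (F : fieldType) (A : lmodType F) (D : {linear A -> A})
    (u v : {poly F}) x :
  coprimep u v -> poly_op u D x = 0 -> poly_op v D x = 0 -> x = 0.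
Proof.
move=> /Bezout_eq1_coprimepP[[a b] /= abE] ux vx.
rewrite -[x]scale1r -(poly_opC D) polyC1 -abE.
by rewrite poly_opDl !poly_opM ux vx !linear0 addr0.
Qed.

(** * The Laguerre polynomial of degree p - 1 modulo p *)

(** Although the reduction map is not a ring morphism on the rationals in
    characteristic p, it is computed by any fraction whose denominator does not
    vanish in F, reduced or not. *)
Lemma ratr_frac (F : fieldType) (z : int) (N : nat) :
  N%:R != 0 :> F -> ratr (z%:~R / N%:R : rat) = z%:~R / N%:R :> F.
Proof.
move=> NF; set q := (z%:~R / N%:R : rat).
have N_neq0 : N != 0%N by apply: contraNneq NF => ->.
have numE : numq q * N%:Z = z * denq q.
  apply: (@mulrIz rat 1) => //; rewrite !intrM.
  have NQ : N%:R != 0 :> rat by rewrite pnatr_eq0.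
  have dQ : (denq q)%:~R != 0 :> rat by rewrite intr_eq0 denq_eq0.
  apply/eqP; rewrite -[X in _ * X]/(N%:R) -eqr_div //.
  by rewrite divq_num_den.
have den_dvd : (denq q %| N%:Z)%Z.
  rewrite -(@Gauss_dvdzr _ (numq q)); last first.
    by rewrite coprimez_sym /coprimez; have := coprime_num_den q; rewrite /coprime.
  by rewrite numE dvdz_mull.
have dF : (denq q)%:~R != 0 :> F.
  apply: contraNneq NF => d0; have /dvdzP[c cE] := den_dvd.
  by rewrite -[N%:R]/(N%:Z%:~R) cE intrM d0 mulr0.
rewrite /ratr; apply/eqP; rewrite eqr_div //.
by rewrite -[N%:R]/(N%:Z%:~R) -!intrM numE.
Qed.

Lemma coefCM_NXn (R : comNzRingType) (c : R) j k :
  (c%:P * (- 'X) ^+ j)`_k = if k == j then (-1) ^+ k * c else 0.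
Proof.
rewrite -scaleN1r exprZn -mul_polyC mulrA -polyCM coefCM coefXn.
by case: eqP => [->|_]; rewrite ?mulr1 ?mulr0 // mulrC.
Qed.

Lemma size_laguerre n : (size (laguerre n) <= n.+1)%N.
Proof.
apply/leq_sizeP => k lt_nk; rewrite coef_sum big1 // => i _.
by rewrite coefCM_NXn gtn_eqF // (leq_trans _ lt_nk).
Qed.

Lemma coef_laguerre n k : (k <= n)%N ->
  (laguerre n)`_k = ((-1) ^+ k / (k`! * (n - k)`!)%:R) *:
     map_poly intr (\prod_(i < n - k) ('X + n%:R - i%:R) : {poly int}).
Proof.
move=> le_kn; rewrite /laguerre coef_sum.
rewrite (bigD1 (Ordinal (le_kn : (k < n.+1)%N))) //=.
rewrite coefCM_NXn eqxx big1 ?addr0; last first.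
  move=> j /eqP j_neq; rewrite coefCM_NXn; case: eqP => // kj; case: j_neq.
  by apply: val_inj; rewrite /= -kj.
have -> : (-1) ^+ k = ((-1) ^+ k)%:P :> {poly rat} by rewrite polyC_exp polyCN.
rewrite mul_polyC /binomial_poly !scalerA natrM invfM.
rewrite rmorph_prod; congr (_ *: _).
by apply: eq_bigr => i _; rewrite rmorphB rmorphD /= map_polyX !rmorph_nat.
Qed.

Lemma coef_laguerre_mod (F : fieldType) n k : n`!%:R != 0 :> F -> (k <= n)%N ->
  (laguerre_mod F n)`_k = ((-1) ^+ k / (k`! * (n - k)`!)%:R) *:
     \prod_(i < n - k) ('X + n%:R - i%:R).
Proof.
move=> nF le_kn.
have knF : (k`! * (n - k)`!)%:R != 0 :> F.
  apply: contraNneq nF => kn0.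
  by rewrite -(bin_fact le_kn) natrM kn0 mulr0.
have ratr0 : ratr 0 = 0 :> F by rewrite /ratr mul0r.
have prodE (R : nzRingType) : \prod_(i < n - k) ('X + n%:R - i%:R) = map_poly intr
    (\prod_(i < n - k) ('X + n%:R - i%:R) : {poly int}) :> {poly R}.
  rewrite rmorph_prod /=.
  by apply: eq_bigr => i _; rewrite rmorphB rmorphD /= map_polyX !rmorph_nat.
rewrite /laguerre_mod coef_map_id0; last first.
  by apply/polyP => j; rewrite coef_map_id0 // !coef0.
rewrite coef_laguerre // (prodE F); apply/polyP => j; rewrite coef_map_id0 //.
set P := \prod_(i < _) _.
have signE (R : nzRingType) : (-1) ^+ k = ((-1) ^+ k : int)%:~R :> R.
  by rewrite rmorphXn rmorphN1.
rewrite !coefZ !coef_map /= -!mulrA ![_^-1 * _]mulrC !mulrA.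
by rewrite (signE F) (signE rat) -!intrM ratr_frac.
Qed.

(** In characteristic p, k + 1 is the opposite of p - 1 - k. *)
Lemma natr_compl_char (R : nzRingType) p k : p \in [pchar R] -> (k.+1 < p)%N ->
  k.+1%:R = - (p.-1 - k)%:R :> R.
Proof.
move=> pR lt_kp; have p_gt0 := ltn_trans (ltn0Sn k) lt_kp.
have lt_k1p : (k < p.-1)%N by rewrite -ltnS prednK.
apply/eqP; rewrite -subr_eq0 opprK -natrD addSn subnKC 1?ltnW //.
by rewrite prednK // (pcharf0 pR).
Qed.

(** Hence all the products k! (p - 1 - k)! agree up to sign; the case k = 0 is
    Wilson's theorem. *)
Lemma fact_mul_fact_char (F : fieldType) p k : p \in [pchar F] -> (k < p)%N ->
  (k`! * (p.-1 - k)`!)%:R = - (-1) ^+ k :> F.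
Proof.
move=> pF; have p_pr := pcharf_prime pF; have p_gt0 := prime_gt0 p_pr.
elim: k => [_|k IH lt_kp].
  rewrite mul1n subn0 expr0; apply/eqP; rewrite -subr_eq0 opprK natr1.
  by rewrite -(dvdn_pcharf pF) -Wilson ?prime_gt1.
have lt_k1p : (k < p.-1)%N by rewrite -ltnS prednK.
have sumF := natr_compl_char pF lt_kp.
rewrite exprS mulN1r -(IH (ltnW lt_kp)) factS subnS.
have : (0 < p.-1 - k)%N by rewrite subn_gt0.
case: (p.-1 - k)%N sumF => // j sumF _ /=.
by rewrite [j.+1`!]factS !natrM sumF !mulNr; congr (- _); rewrite mulrCA mulrA.
Qed.

(** The Laguerre polynomial of degree p - 1 modulo p in the variable X, where a
    polynomial v in X has been substituted for the parameter alpha. The factors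
    (-1)^k / (k! (p - 1 - k)!) are all equal to -1. *)
Definition laguerre_sub (F : fieldType) (p : nat) (v : {poly F}) : {poly F} :=
  - \sum_(k < p) (\prod_(i < p.-1 - k) (v - i.+1%:R)) * 'X^k.

Lemma laguerre_subE (F : fieldType) p (v : {poly F}) : p \in [pchar F] ->
  \sum_(k < size (laguerre_mod F p.-1)) ((laguerre_mod F p.-1)`_k \Po v) * 'X^k =
  laguerre_sub p v.
Proof.
move=> pF; have p_pr := pcharf_prime pF; have p_gt0 := prime_gt0 p_pr.
set L := laguerre_mod _ _.
have sizeL : (size L <= p)%N.
  apply: leq_trans (size_poly _ _) _.
  by rewrite (leq_trans (size_laguerre _)) ?prednK.
rewrite (big_ord_widen _ (fun k => (L`_k \Po v) * 'X^k) sizeL).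
rewrite big_mkcond /laguerre_sub -sumrN.
apply: eq_bigr => -[k lt_kp] _ /=.
transitivity ((L`_k \Po v) * 'X^k).
  by case: ltnP => // /leq_sizeP->//; rewrite comp_poly0 mul0r.
have pF1 (R : nzRingType) : p \in [pchar R] -> p.-1%:R = -1 :> R.
  by move=> pR; apply/eqP; rewrite -addr_eq0 natr1 prednK // (pcharf0 pR).
have factF : p.-1`!%:R != 0 :> F.
  have := fact_mul_fact_char pF p_gt0; rewrite mul1n subn0 => ->.
  by rewrite expr0 oppr_eq0 oner_neq0.
have le_kp : (k <= p.-1)%N by rewrite -ltnS prednK.
rewrite -mulNr coef_laguerre_mod ?fact_mul_fact_char //.
rewrite invrN mulrN divff ?signr_eq0 // scaleN1r rmorphN /=; congr (- _ * _).
rewrite rmorph_prod /=; apply: eq_bigr => i _.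
rewrite rmorphB rmorphD /= comp_polyX !rmorph_nat pF1 ?pchar_poly //.
by rewrite -addrA -opprD [1 + _]addrC natr1.
Qed.

Lemma prod_sub_nat (F : fieldType) p (v : {poly F}) : p \in [pchar F] ->
  \prod_(i < p) (v - i%:R) = v ^+ p - v.
Proof.
move=> pF; have p_pr := pcharf_prime pF; have p_gt1 := prime_gt1 p_pr.
suff /(congr1 (fun q => q \Po v)) :
    \prod_(i < p) ('X - i%:R%:P) = 'X^p - 'X :> {poly F}.
  rewrite rmorph_prod rmorphB /= comp_Xn_poly comp_polyX => <-.
  by apply: eq_bigr => i _; rewrite rmorphB /= comp_polyX polyC_natr rmorph_nat.
have size_q : size ('X^p - 'X : {poly F}) = p.+1.
  by rewrite size_polyDl ?size_polyXn // size_polyN size_polyX ltnS.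
have lead_q : lead_coef ('X^p - 'X : {poly F}) = 1.
  by rewrite lead_coefDl ?lead_coefXn // size_polyN size_polyX size_polyXn ltnS.
rewrite [RHS](@all_roots_prod_XsubC _ _ [seq i%:R | i <- iota 0 p]).
- rewrite lead_q scale1r big_map.
  by rewrite -[X in iota 0 X](subn0 p) -/(index_iota 0 p) big_mkord.
- by rewrite size_q size_map size_iota.
- apply/allP => _ /mapP[i _ ->].
  rewrite rootE !hornerE.
  by rewrite -(pFrobenius_autE pF) pFrobenius_aut_nat subrr.
rewrite uniq_rootsE map_inj_in_uniq ?iota_uniq // => i j.
rewrite !mem_iota /= !add0n => ip jp.
wlog le_ij : i j ip jp / (i <= j)%N.
  by move=> th; case/orP: (leq_total i j) => le eqij; [exact: th|apply/esym/th].
move/esym/eqP; rewrite -subr_eq0 -natrB // -(dvdn_pcharf pF) => /dvdn_leq.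
rewrite subn_gt0 => dvd_le; apply/eqP; rewrite eqn_leq le_ij leqNgt.
apply/negP => /dvd_le; rewrite leqNgt => /negP; apply.
by rewrite (leq_ltn_trans (leq_subr _ _)).
Qed.

Lemma horner_laguerre_sub (F : fieldType) p (v : {poly F}) x :
  (laguerre_sub p v).[x] = (laguerre_sub p v.[x]%:P).[x].
Proof.
rewrite !hornerN !horner_sum; congr (- _); apply: eq_bigr => k _.
rewrite !hornerM !horner_prod; congr (_ * _); apply: eq_bigr => i _.
by rewrite !hornerE.
Qed.

(** The differential equation: modulo X^p - (v^p - v), the polynomial behaves
    like X^(-v) exp X. *)
Lemma laguerre_sub_ode (F : fieldType) p (v : {poly F}) : p \in [pchar F] ->
  v^`() = 0 ->
  'X * (laguerre_sub p v)^`() =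
  ('X - v) * laguerre_sub p v + ('X^p - (v ^+ p - v)).
Proof.
move=> pF dv0; have p_pr := pcharf_prime pF; have p_gt0 := prime_gt0 p_pr.
have pFX : p \in [pchar {poly F}] by rewrite pchar_poly.
pose c k := \prod_(i < p.-1 - k) (v - i.+1%:R).
have dc0 k : (c k)^`() = 0.
  rewrite /c; elim/big_ind: _ => [|x y x0 y0|i _]; first by rewrite derivC.
    by rewrite derivM x0 y0 mul0r mulr0 addr0.
  by rewrite derivB dv0 -polyC_natr derivC subrr.
have cS k : (k.+1 < p)%N -> c k = (k.+1%:R + v) * c k.+1.
  move=> lt_kp; have lt_k1p : (k < p.-1)%N by rewrite -ltnS prednK.
  have := natr_compl_char (pFX : p \in [pchar {poly F}]) lt_kp.
  have : (0 < p.-1 - k)%N by rewrite subn_gt0.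
  rewrite /c subnS; case: (p.-1 - k)%N => // j _ ->.
  by rewrite big_ord_recr mulrC addrC.
have c0 : v * c 0%N = v ^+ p - v.
  rewrite -prod_sub_nat // /c subn0 -[in RHS](prednK p_gt0) big_ord_recl /=.
  by rewrite subr0; congr (_ * _); apply: eq_bigr => i _; rewrite lift0.
have clast : c p.-1 = 1 by rewrite /c subnn big_ord0.
rewrite -[laguerre_sub p v]/(- \sum_(k < p) c k * 'X^k) derivN raddf_sum /=.
have sumE : \sum_(k < p) (k%:R + v) * c k * 'X^k =
    v * c 0%N + 'X * \sum_(k < p) c k * 'X^k - 'X^p.
  rewrite -(prednK p_gt0) big_ord_recl /= add0r expr0 mulr1 -addrA; congr (_ + _).
  rewrite big_ord_recr /= prednK // clast mul1r mulrDr -exprS.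
  rewrite prednK // addrK mulr_sumr.
  apply: eq_bigr => k _; rewrite /bump leq0n add1n -cS; last first.
    by rewrite -[X in (_ < X)%N](prednK p_gt0) ltnS.
  by rewrite exprS mulrCA.
rewrite (eq_bigr (fun k : 'I_p => c k * (k%:R * 'X^(k.-1)))); last first.
  by move=> k _; rewrite derivM dc0 mul0r add0r derivXn mulr_natl.
have dE : 'X * \sum_(k < p) c k * (k%:R * 'X^(k.-1)) =
    v * c 0%N + 'X * (\sum_(k < p) c k * 'X^k) - 'X^p - v * \sum_(k < p) c k * 'X^k.
  rewrite -sumE !mulr_sumr -sumrB; apply: eq_bigr => -[[|k] lt_kp] _ /=; last first.
    by rewrite exprS; ring.
  by rewrite expr0; ring.
by rewrite mulrN dE c0; ring.
Qed.

Lemma size_laguerre_sub (F : fieldType) p (v : F) : (0 < p)%N ->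
  size (laguerre_sub p v%:P) = p.
Proof.
move=> p_gt0; rewrite size_polyN.
pose c k : F := \prod_(i < p.-1 - k) (v - i.+1%:R).
have -> : \sum_(k < p) (\prod_(i < p.-1 - k) (v%:P - i.+1%:R)) * 'X^k =
          \poly_(k < p) c k.
  rewrite poly_def; apply: eq_bigr => k _; rewrite -mul_polyC /c; congr (_ * _).
  by rewrite rmorph_prod; apply: eq_bigr => i _; rewrite rmorphB /= polyC_natr.
case: p p_gt0 @c => // n _ c; rewrite size_poly_eq // /c /= subnn big_ord0.
exact: oner_neq0.
Qed.

(** If x is a zero of order m, with 0 < m < p, then the order of X L' at x is
    m - 1 when x is nonzero, whereas the other terms of the differential equation
    vanish to order at least m. If x is 0, then so is a, and the value is up to
    sign the product of the numbers -1, ..., -(p - 1). *)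
Lemma horner_laguerre_sub_neq0 (F : fieldType) p (a x : F) : p \in [pchar F] ->
  a ^+ p - a = x ^+ p -> (x = 0 -> a = 0) -> (laguerre_sub p a%:P).[x] != 0.
Proof.
move=> pF aE x0a; have p_gt0 := prime_gt0 (pcharf_prime pF).
have [x0|x_neq0] := eqVneq x 0.
  rewrite x0 (x0a x0) !hornerE horner_sum; case: p pF p_gt0 {aE} => // n nF _.
  rewrite big_ord_recl [X in _ + X]big1 => [|i _]; last first.
    by rewrite !hornerE lift0 expr0n mulr0.
  rewrite addr0 !hornerE oppr_eq0 horner_prod.
  apply/prodf_neq0 => -[i lt_in] _ /=.
  rewrite -polyC_natr !hornerE oppr_eq0 -(dvdn_pcharf nF).
  apply/negP => /dvdn_leq-/(_ isT); rewrite ltnS leqNgt.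
  by rewrite /= subn0 in lt_in; rewrite lt_in.
set L := laguerre_sub p a%:P; apply/negP => rootL.
have sizeL : size L = p by apply: size_laguerre_sub.
have L_neq0 : L != 0 by rewrite -size_poly_eq0 sizeL -lt0n.
have [m [q]] := multiplicity_XsubC L x; rewrite L_neq0 /= => q_neq0 LE.
have m_gt0 : (0 < m)%N.
  by case: m LE => // LE; move: rootL q_neq0; rewrite LE expr0 mulr1 rootE => ->.
have lt_mp : (m < p)%N.
  have q0 : q != 0 by apply: contraNneq q_neq0 => ->; rewrite root0.
  rewrite -sizeL LE size_Mmonic ?monic_exp ?monicXsubC // size_exp_XsubC addnS /=.
  by rewrite -[X in (X < _)%N]add0n ltn_add2r size_poly_gt0.
have := laguerre_sub_ode pF (derivC a).
rewrite -/L -rmorphXn -rmorphB aE rmorphXn /=.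
have pFX : p \in [pchar {poly F}] by rewrite pchar_poly.
have -> : 'X^p - x%:P ^+ p = ('X - x%:P) ^+ p.
  by rewrite -!(pFrobenius_autE pFX) rmorphB.
case: m m_gt0 lt_mp LE => // m _ lt_mp LE.
rewrite LE derivM deriv_exp derivXsubC mul1r /=.
rewrite -(subnK lt_mp) exprD.
set Z := 'X - x%:P => odeL.
(* The differential equation divided by Z^m is evaluated at x. *)
have Zm_neq0 : Z ^+ m != 0 by rewrite expf_neq0 // polyXsubC_eq0.
have : 'X * (q^`() * Z + q *+ m.+1) = ('X - a%:P) * q * Z + Z ^+ (p - m.+2).+2.
  apply: (mulIf Zm_neq0); rewrite !exprS mulrDl.
  move: odeL; rewrite !exprS -(mulr_natr q) -(mulr_natr (Z ^+ m)) => odeL.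
  transitivity ('X * (q^`() * (Z * Z ^+ m) + q * (Z ^+ m * m.+1%:R))).
    by ring.
  by rewrite odeL; ring.
move/(congr1 (fun P => P.[x])).
rewrite !(hornerE, hornerMn) subrr !mulr0 !add0r exprS mul0r.
move=> /eqP; rewrite mulf_eq0 (negPf x_neq0) /= -mulr_natl mulf_eq0.
rewrite -rootE (negPf q_neq0) orbF -(dvdn_pcharf pF) => /dvdn_leq-/(_ isT).
by rewrite leqNgt lt_mp.
Qed.

(** * The product of two Laguerre polynomials *)

(** If the logarithmic derivatives of l1 and l2 under a derivation E add up to
    that of s, modulo f1 and f2, then E annihilates the quotient l1 l2 / s modulo
    f1 and f2. Here w is an inverse of s modulo f1 + f2, and El1, ..., Ev stand
    for the images of l1, ..., v under E. *)
Lemma euler_quotient (R : comNzRingType)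
    (X Y A B l1 l2 s w v f1 f2 El1 El2 Es Ew Ev : R) :
  w * s + v * (f1 + f2) = 1 ->
  El1 = (X - A) * l1 + f1 -> El2 = (Y - B) * l2 + f2 ->
  Es = (X + Y - (A + B)) * s + (f1 + f2) ->
  Ew * s + w * Es + Ev * (f1 + f2) = 0 ->
  exists K : R, (El1 * l2 + l1 * El2) * w + l1 * l2 * Ew =
    (l2 * w + K) * f1 + (l1 * w + K) * f2.
Proof.
move=> ws1 -> -> EsE Ews.
exists (l1 * l2 * ((X + Y - (A + B)) * w * v - w * w - w * Ev + v * Ew)).
have wsE : w * s = 1 - v * (f1 + f2) by rewrite -ws1 addrK.
have EwsE : Ew * s = - (w * Es) - Ev * (f1 + f2).
  by apply/eqP; rewrite -subr_eq0 -Ews; apply/eqP; ring.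
have EwE : Ew = w * (Ew * s) + v * (f1 + f2) * Ew.
  by rewrite -[LHS]mul1r -ws1; ring.
have {EwE} EwE : Ew = - (X + Y - (A + B)) * w * (w * s)
    - w * w * (f1 + f2) - w * Ev * (f1 + f2) + v * (f1 + f2) * Ew.
  by rewrite [LHS]EwE EwsE EsE; ring.
by rewrite [Ew in LHS]EwE wsE; ring.
Qed.

Section Euler.
Variable F : fieldType.
Implicit Types (P Q : {poly {poly F}}) (u v : {poly F}).

(** The value at z of a polynomial in one variable with coefficients in F. An
    element of {poly {poly F}} is regarded as a polynomial in two variables X and
    Y, where X is the inner variable 'X%:P and Y the outer variable 'X. *)
Definition subst2 (z : {poly {poly F}}) : {poly F} -> {poly {poly F}} :=
  horner_eval z \o map_poly (polyC \o polyC).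
HB.instance Definition _ z := GRing.RMorphism.on (subst2 z).

Lemma subst2X z : subst2 z 'X = z.
Proof. by rewrite /subst2 /= map_polyX /horner_eval hornerX. Qed.

Lemma subst2C z c : subst2 z c%:P = c%:P%:P.
Proof. by rewrite /subst2 /= map_polyC /horner_eval hornerC. Qed.

Lemma subst2B z u v : subst2 z (u - v) = subst2 z u - subst2 z v.
Proof. exact: rmorphB. Qed.

(** The Euler derivation, which multiplies a monomial by its total degree. *)
Definition euler P : {poly {poly F}} :=
  'X%:P * map_poly (@deriv F) P + 'X * P^`().

Lemma coef_euler P i j : (euler P)`_j`_i = (i + j)%:R * P`_j`_i.
Proof.
rewrite coefD coefCM coefXM natrD mulrDl coefD coef_map_id0 ?deriv0 //.
rewrite coefXM coef_deriv; congr (_ + _).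
  by case: i => [|i] /=; rewrite ?mul0r // mulr_natl.
by case: j => [|j] /=; rewrite ?coef0 ?mul0r // coef_deriv coefMn mulr_natl.
Qed.

Lemma euler_is_additive : additive euler.
Proof.
move=> P Q; apply/polyP => j; apply/polyP => i.
by rewrite !(coefB, coef_euler) mulrBr.
Qed.
HB.instance Definition _ := GRing.isAdditive.Build _ _ euler euler_is_additive.

Lemma eulerM P Q : euler (P * Q) = euler P * Q + P * euler Q.
Proof.
have dM : map_poly (@deriv F) (P * Q) =
    map_poly (@deriv F) P * Q + P * map_poly (@deriv F) Q.
  apply/polyP => n; rewrite coef_map_id0 ?deriv0 //.
  rewrite coefD !coefM raddf_sum -big_split.
  apply: eq_bigr => i _ /=; rewrite derivM !coef_map_id0 ?deriv0 //.
by rewrite /euler dM derivM; ring.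
Qed.

Lemma eulerC c : euler c%:P%:P = 0.
Proof. by rewrite /euler map_polyC /= !derivC !mulr0 addr0. Qed.

Lemma euler_subst2 z u : euler z = z -> euler (subst2 z u) = subst2 z ('X * u^`()).
Proof.
move=> Ez; elim/poly_ind: u => [|u c IH].
  by rewrite deriv0 mulr0 rmorph0 raddf0.
rewrite derivD derivM derivX derivC !(rmorphD, rmorphM) /= raddfD /= eulerM.
by rewrite !subst2X subst2C eulerC IH Ez !(rmorphM, rmorph1) /= subst2X; ring.
Qed.

Lemma euler_outer : euler 'X = 'X.
Proof.
rewrite /euler derivX mulr1 -[RHS]add0r; congr (_ + _).
rewrite (_ : map_poly _ _ = 0) ?mulr0 //; apply/polyP => i.
by rewrite coef_map_id0 ?deriv0 // coefX coef0; case: eqP; rewrite ?deriv0 ?derivC.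
Qed.

Lemma euler_inner : euler 'X%:P = 'X%:P.
Proof. by rewrite /euler map_polyC /= derivX derivC mulr0 mulr1 addr0. Qed.

Lemma exprB_exponent (R : comNzRingType) p r (x y : R) : p \in [pchar R] ->
  (x - y) ^+ (p ^ r) = x ^+ (p ^ r) - y ^+ (p ^ r).
Proof.
move=> pR; elim: r => [|n IH]; first by rewrite expn0 !expr1.
by rewrite expnSr !exprM IH -!(pFrobenius_autE pR) rmorphB.
Qed.

Lemma exprD_exponent (R : comNzRingType) p r (x y : R) : p \in [pchar R] ->
  (x + y) ^+ (p ^ r) = x ^+ (p ^ r) + y ^+ (p ^ r).
Proof.
move=> pR; apply/eqP; rewrite -subr_eq -exprB_exponent //.
by rewrite addrK.
Qed.

(** With q = p^r, X^q - t^q = (X - t)^q is coprime to every polynomial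
    not vanishing at t. *)
Lemma coprimep_XnsubC_exponent p r u t : p \in [pchar F] -> u.[t] != 0 ->
  coprimep u ('X^(p ^ r) - (t ^+ (p ^ r))%:P).
Proof.
move=> pF ut_neq0; have pFX : p \in [pchar {poly F}] by rewrite pchar_poly.
rewrite rmorphXn /= -exprB_exponent // coprimep_expr //.
by rewrite coprimep_XsubC.
Qed.

Section Switch.
Variables (p r : nat) (rho sigma : F).
Hypotheses (pF : p \in [pchar F]) (r_gt0 : (0 < r)%N).
Let q := (p ^ r)%N.
Let tau := rho + sigma.
Let f t : {poly F} := 'X^q - (t ^+ q)%:P.

Lemma dvd_exponent : (p %| q)%N. Proof. exact: dvdn_exp. Qed.

Lemma euler_f t z : euler z = z -> euler (subst2 z (f t)) = 0.
Proof.
move=> Ez; rewrite euler_subst2 // derivB derivC subr0 derivXn.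
have pFX : p \in [pchar {poly F}] by rewrite pchar_poly.
suff -> : 'X^(q.-1) *+ q = 0 :> {poly F} by rewrite mulr0 rmorph0.
have /dvdnP[k ->] := dvd_exponent.
by rewrite mulrnA -mulr_natr pcharf0 // mulr0.
Qed.

Lemma subst2_fD :
  subst2 ('X%:P + 'X) (f tau) = subst2 'X%:P (f rho) + subst2 'X (f sigma).
Proof.
have pFXX : p \in [pchar {poly {poly F}}] by rewrite !pchar_poly.
rewrite /f !rmorphB !rmorphXn /= !subst2X !subst2C /tau !exprD_exponent // !polyCD.
by rewrite [(_%:P%:P + _) ^+ q]exprD_exponent //; ring.
Qed.

Variables a b c : {poly F}.
Hypotheses (da : a^`() = 0) (db : b^`() = 0) (dc : c^`() = 0).
Hypotheses (aE : 'X^p - (a ^+ p - a) = f rho) (bE : 'X^p - (b ^+ p - b) = f sigma).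
Hypotheses (cE : 'X^p - (c ^+ p - c) = f tau).
Hypothesis cD : subst2 ('X%:P + 'X) c = subst2 'X%:P a + subst2 'X b.
Hypothesis Lc_neq0 : (laguerre_sub p c).[tau] != 0.

(** Modulo X^q - rho^q and Y^q - sigma^q, the product of the Laguerre
    polynomials in X and in Y is the one in X + Y, up to a factor C all of whose
    monomials have total degree divisible by p. *)
Lemma laguerre_sub_switch : exists C P1 P2 : {poly {poly F}},
  subst2 'X%:P (laguerre_sub p a) * subst2 'X (laguerre_sub p b) =
  subst2 ('X%:P + 'X) (laguerre_sub p c) * C
    + P1 * subst2 'X%:P (f rho) + P2 * subst2 'X (f sigma) /\
  forall i j, C`_j`_i != 0 -> (p %| i + j)%N.
Proof.
have EX : euler 'X%:P = 'X%:P := euler_inner.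
have EY : euler 'X = 'X := euler_outer.
have ES : euler ('X%:P + 'X) = 'X%:P + 'X by rewrite raddfD /= EX EY.
have cDS := cD; set S := 'X%:P + 'X in ES cDS *.
have /Bezout_eq1_coprimepP[[u v] /= uvE] := coprimep_XnsubC_exponent r pF Lc_neq0.
set l1 := subst2 _ (laguerre_sub p a); set l2 := subst2 _ (laguerre_sub p b).
set s := subst2 _ (laguerre_sub p c).
have f3E := subst2_fD.
set f1 := subst2 _ (f rho) in f3E *; set f2 := subst2 _ (f sigma) in f3E *.
set f3 := subst2 _ (f tau) in f3E.
pose w := subst2 S u; pose v' := subst2 S v.
have swE : w * s + v' * f3 = 1 by rewrite -!rmorphM -rmorphD uvE rmorph1.
have Ef1 : euler f1 = 0 by apply: euler_f.
have Ef2 : euler f2 = 0 by apply: euler_f.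
have Ef3 : euler f3 = 0 by apply: euler_f.
have El z d t : euler z = z -> d^`() = 0 -> 'X^p - (d ^+ p - d) = f t ->
    euler (subst2 z (laguerre_sub p d)) =
    (z - subst2 z d) * subst2 z (laguerre_sub p d) + subst2 z (f t).
  move=> Ez dd dE; rewrite euler_subst2 // laguerre_sub_ode // dE.
  by rewrite rmorphD rmorphM rmorphB /= subst2X.
have El1 := El _ _ _ EX da aE; have El2 := El _ _ _ EY db bE.
have Es := El _ _ _ ES dc cE.
rewrite -/l1 -/l2 -/s -/f1 -/f2 -/f3 in El1 El2 Es.
have Ew : euler w * s + w * euler s + euler v' * f3 = 0.
  have := congr1 euler swE; rewrite raddfD /= !eulerM Ef3 mulr0 addr0.
  by rewrite -[1 in RHS]/(1%:P%:P) eulerC.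
pose inI P := exists P1 P2, P = P1 * f1 + P2 * f2.
pose C := l1 * l2 * w.
have EC : inI (euler C).
  rewrite /S cDS f3E in swE Es Ew; rewrite /inI /C !eulerM.
  by have [K ->] := euler_quotient swE El1 El2 Es Ew; do 2!eexists.
have EI P : inI P -> inI (euler P).
  move=> [P1 [P2 ->]]; exists (euler P1), (euler P2).
  by rewrite raddfD /= !eulerM Ef1 Ef2 !mulr0 !addr0.
(* On a monomial of total degree n, the operator 1 - E^(p-1) is multiplication by
   1 - n^(p-1), that is, by 0 or 1 according to whether p fails to divide n or
   divides it; and E^(p-1) C lies in the ideal. *)
have p_gt1 := prime_gt1 (pcharf_prime pF).
have EnI n : inI (iter n.+1 euler C) by elim: n => //= n; apply: EI.
have [P1 [P2 EpE]] : inI (iter p.-1 euler C).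
  by rewrite -(prednK (_ : 0 < p.-1)%N) // -ltnS prednK // ltnW.
exists (C - iter p.-1 euler C), (s * P1 + l1 * l2 * v'), (s * P2 + l1 * l2 * v').
split.
  rewrite -[LHS]mulr1 -swE.
  by rewrite EpE f3E /C; ring.
move=> i j; rewrite !coefB.
have -> n : (iter n euler C)`_j`_i = (i + j)%:R ^+ n * C`_j`_i.
  elim: n => [|n IH]; first by rewrite mul1r.
  by rewrite iterS coef_euler IH mulrA exprS.
apply: contraR => ndvd; rewrite -[X in X - _]mul1r -mulrBl.
suff -> : (i + j)%:R ^+ p.-1 = 1 :> F by rewrite subrr mul0r.
have ij_neq0 : (i + j)%:R != 0 :> F by rewrite -(dvdn_pcharf pF).
apply: (mulfI ij_neq0); rewrite -exprS prednK 1?ltnW // mulr1.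
by rewrite -(pFrobenius_autE pF) pFrobenius_aut_nat.
Qed.
End Switch.
End Euler.

(** * Polynomials in two variables acting on the multiplication *)

Section BivariateAction.
Variables (F : fieldType) (A : lmodType F) (mul : {bilinear A -> A -> A}).
Variable D : {linear A -> A}.
Implicit Types (P Q : {poly {poly F}}) (u : {poly F}) (x y : A).

(** The action of P on the product of x and y, where X acts as D on the first
    factor and Y as D on the second: X^i Y^j gives (D^i x)(D^j y). *)
Definition poly2_mul P x y : A :=
  \sum_(j < size P) mul (poly_op P`_j D x) (iter j D y).

Lemma poly2_mul_wide n P x y : (size P <= n)%N ->
  poly2_mul P x y = \sum_(j < n) mul (poly_op P`_j D x) (iter j D y).
Proof.
move=> le_Pn; rewrite /poly2_mul.
rewrite (big_ord_widen _ (fun j => mul (poly_op P`_j D x) (iter j D y)) le_Pn).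
rewrite big_mkcond; apply: eq_bigr => i _; case: ltnP => // /leq_sizeP->//.
by rewrite poly_op0 linear0l.
Qed.

Lemma poly2_mulDl P Q x y :
  poly2_mul (P + Q) x y = poly2_mul P x y + poly2_mul Q x y.
Proof.
pose n := maxn (size (P + Q)) (maxn (size P) (size Q)).
rewrite (@poly2_mul_wide n) ?leq_maxl //.
rewrite (@poly2_mul_wide n P) ?(@poly2_mul_wide n Q).
- by rewrite -big_split; apply: eq_bigr => i _; rewrite coefD poly_opDl linearDl.
- by rewrite /n !leq_max leqnn !orbT.
- by rewrite /n !leq_max leqnn !orbT.
Qed.

Lemma poly2_mul0 x y : poly2_mul 0 x y = 0.
Proof. by rewrite (@poly2_mul_wide 0) ?size_poly0 // big_ord0. Qed.

Lemma poly2_mul1 x y : poly2_mul 1 x y = mul x y.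
Proof.
by rewrite (@poly2_mul_wide 1) ?size_poly1 // big_ord1 coef1 poly_opC scale1r.
Qed.

Lemma poly2_mul0l P y : poly2_mul P 0 y = 0.
Proof. by rewrite /poly2_mul big1 // => i _; rewrite linear0 linear0l. Qed.

Lemma poly2_mul0r P x : poly2_mul P x 0 = 0.
Proof. by rewrite /poly2_mul big1 // => i _; rewrite linear0 linear0r. Qed.

Lemma poly2_mul_is_linearr P x : linear (poly2_mul P x).
Proof.
move=> a y y'; rewrite scaler_sumr -big_split; apply: eq_bigr => i _ /=.
by rewrite linearP linearDr linearZr_LR.
Qed.

HB.instance Definition _ P x :=
  GRing.isLinear.Build F A A *:%R (poly2_mul P x) (poly2_mul_is_linearr P x).

Lemma poly2_mulMC u P x y :
  poly2_mul (u%:P * P) x y = poly2_mul P (poly_op u D x) y.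
Proof.
rewrite mul_polyC (@poly2_mul_wide (size P)) ?size_scale_leq //.
by apply: eq_bigr => i _; rewrite coefZ mulrC poly_opM.
Qed.

Lemma poly2_mulMX P x y : poly2_mul ('X * P) x y = poly2_mul P x (D y).
Proof.
rewrite (@poly2_mul_wide (size P).+1); last first.
  by rewrite (leq_trans (size_polyMleq _ _)) // size_polyX.
rewrite big_ord_recl coefXM poly_op0 linear0l add0r; apply: eq_bigr => i _.
by rewrite coefXM lift0 -iterSr.
Qed.

Lemma poly2_mulMCC c P x y : poly2_mul (c%:P%:P * P) x y = c *: poly2_mul P x y.
Proof.
rewrite poly2_mulMC poly_opC scaler_sumr; apply: eq_bigr => i _.
by rewrite linearZ linearZl_LR.
Qed.

Lemma poly2_mul_substl u P x y :
  poly2_mul (subst2 'X%:P u * P) x y = poly2_mul P (poly_op u D x) y.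
Proof.
have -> : subst2 'X%:P u = u%:P; last exact: poly2_mulMC.
elim/poly_ind: u => [|u c IH]; first by rewrite rmorph0.
by rewrite !(rmorphD, rmorphM) /= subst2X subst2C IH.
Qed.

Lemma poly2_mul_substr u P x y :
  poly2_mul (subst2 'X u * P) x y = poly2_mul P x (poly_op u D y).
Proof.
elim/poly_ind: u P y => [|u c IH] P y.
  by rewrite rmorph0 mul0r poly2_mul0 poly_op0 poly2_mul0r.
rewrite !(rmorphD, rmorphM) /= subst2X subst2C mulrDl -mulrA !poly2_mulDl.
rewrite IH poly2_mulMX poly2_mulMCC poly_opDl poly_opMX poly_opC linearD linearZ /=.
by have := poly_op_comm D u 'X y; rewrite !poly_opX => ->.
Qed.

Hypothesis derD : is_derivation mul D.

(** By the Leibniz rule, X + Y acts as D on the product. *)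
Lemma poly2_mulMS P x y : poly2_mul (('X%:P + 'X) * P) x y = D (poly2_mul P x y).
Proof.
rewrite mulrDl poly2_mulDl poly2_mulMC poly_opX poly2_mulMX /poly2_mul.
rewrite -big_split linear_sum; apply: eq_bigr => i _ /=.
rewrite derD -iterSr -iterS; congr (mul _ _ + _).
by have := poly_op_comm D P`_i 'X x; rewrite !poly_opX.
Qed.

Lemma poly2_mul_substD u P x y :
  poly2_mul (subst2 ('X%:P + 'X) u * P) x y = poly_op u D (poly2_mul P x y).
Proof.
elim/poly_ind: u P => [|u c IH] P.
  by rewrite rmorph0 mul0r poly2_mul0 poly_op0.
rewrite !(rmorphD, rmorphM) /= subst2X subst2C mulrDl -mulrA !poly2_mulDl.
by rewrite IH poly2_mulMS poly2_mulMCC poly_opDl poly_opMX poly_opC.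
Qed.

Lemma poly2_mul_mem (V : set A) P x y : GRing.submod_closed (mem V) ->
  (forall i j, P`_j`_i != 0 -> V (mul (iter i D x) (iter j D y))) ->
  V (poly2_mul P x y).
Proof.
move=> /[dup] subV /submod_closedP[V0 VD] VP.
apply: submod_sum => // j; rewrite linear_sumlz; apply: submod_sum => // i.
rewrite linearZl_LR /=.
have [->|Pij] := eqVneq P`_j`_i 0; first by rewrite scale0r.
by rewrite -[_ *: _]addr0; apply: VD => //; apply: VP.
Qed.

End BivariateAction.

(** * Images and homogeneous components in direct sums *)

Section MoreDirectSums.
Variables (F : fieldType) (A : lmodType F).

Lemma direct_sum_reindex (I J : choiceType) (V : J -> set A) (e : I -> J) :
  bijective e -> is_direct_sum V -> is_direct_sum (V \o e).
Proof.
move=> [e' eK e'K] /is_direct_sumP[Vsub Vspan Vind]; apply/is_direct_sumP.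
split=> [i|x|s f s_uniq Vf]; first exact: Vsub.
- have [s [f [s_uniq Vf ->]]] := Vspan x.
  exists (map e' s), (f \o e); split => [|i|].
  + by rewrite map_inj_uniq //; apply: can_inj e'K.
  + exact: Vf.
  + by rewrite big_map; apply: eq_bigr => j _ /=; rewrite e'K.
move=> sum0 i iS.
have -> : f i = (f \o e') (e i) by rewrite /= eK.
apply: (Vind (map e s)); last exact: map_f.
- by rewrite map_inj_uniq //; apply: can_inj eK.
- by move=> j; have := Vf (e' j); rewrite /= e'K.
- by rewrite big_map -[RHS]sum0; apply: eq_bigr => j _ /=; rewrite eK.
Qed.

Lemma direct_sum_image (I : choiceType) (V : I -> set A) (L : {linear A -> A}) :
  injective L -> (forall y, exists x, L x = y) ->
  is_direct_sum V -> is_direct_sum (fun i => L @` V i).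
Proof.
move=> L_inj L_surj /is_direct_sumP[Vsub Vspan Vind]; apply/is_direct_sumP.
split=> [i|y|s f s_uniq Vf sum0].
- have /submod_closedP[V0 VD] := Vsub i; apply/submod_closedP; split.
    by exists 0; rewrite ?linear0.
  move=> a _ _ [x Vx <-] [y Vy <-]; exists (a *: x + y); first exact: VD.
  by rewrite linearP.
- have [x <-] := L_surj y; have [s [f [s_uniq Vf ->]]] := Vspan x.
  exists s, (L \o f); split=> // [i|]; last by rewrite linear_sum.
  by exists (f i).
have /choice[f' f'P] : forall i, exists x, V i x /\ L x = f i.
  by move=> i; have [x] := Vf i; exists x.
move=> i iS; have [_ <-] := f'P i.
rewrite (Vind s f' s_uniq _ _ i iS) ?linear0 // => [j|]; first by have [] := f'P j.
apply: L_inj; rewrite linear0 linear_sum -[RHS]sum0.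
by apply: eq_bigr => j _; have [] := f'P j.
Qed.

Lemma direct_sum_proj (I : choiceType) (V : I -> set A) i : is_direct_sum V ->
  exists pi : {linear A -> A},
    [/\ forall x, V i (pi x), forall x, V i x -> pi x = x &
        forall j x, j != i -> V j x -> pi x = 0].
Proof.
move=> dirV; have [pi piP] := direct_sum_extend
  (fun j => if j == i then idfun : {linear A -> A} else \0 : {linear A -> A}) dirV.
have [Vsub Vspan _] := (is_direct_sumP V).1 dirV.
exists pi; split => [x|x Vx|j x /negPf ji Vx]; last first.
- by rewrite (piP j) // ji.
- by rewrite (piP i) // eqxx.
have [s [f [_ Vf ->]]] := Vspan x; rewrite linear_sum.
apply: submod_sum => // j; rewrite (piP j) //.
have [<-//|_] := eqVneq j i; by have /submod_closedP[] := Vsub i.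
Qed.

(** When T is diagonalizable and preserves the summands, an element of a summand
    is a sum of eigenvectors of T in the same summand: the projection onto that
    summand commutes with T. *)
Lemma eigenvectors_homogeneous (I : choiceType) (V : I -> set A)
    (T : {linear A -> A}) (i : I) (x : A) :
  is_direct_sum V -> (forall j y, V j y -> V j (T y)) ->
  diagonalizable_op T -> V i x ->
  exists (s : seq F) (f : F -> A),
    (forall c, eigenspace_of T c (f c) /\ V i (f c)) /\ x = \sum_(c <- s) f c.
Proof.
move=> dirV TV /is_direct_sumP[_ Tspan _] Vx.
have [pi [piV piE pi0]] := direct_sum_proj i dirV.
have [Vsub Vspan _] := (is_direct_sumP V).1 dirV.
have piT y : pi (T y) = T (pi y).
  have [s [f [_ Vf ->]]] := Vspan y; rewrite !linear_sum /=.
  apply: eq_bigr => j _; have [ji|ji] := eqVneq j i.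
    by rewrite !piE // -ji //; apply: TV.
  by rewrite !(pi0 j) ?linear0 //; apply: TV.
have [s [f [_ Tf xE]]] := Tspan x; exists s, (pi \o f); split => [c|].
  split; last exact: piV.
  have TfE : T (f c) = c *: f c := Tf c.
  by rewrite /eigenspace_of /= -piT TfE linearZ.
by rewrite -[LHS]piE // xE linear_sum.
Qed.

End MoreDirectSums.

(** * Powers of the Frobenius map and p-polynomials *)

Section Frobenius.
Variables (F : fieldType) (p : nat).
Hypothesis pF : p \in [pchar F].

Lemma p_polynomial_hornerD (g : {poly F}) x y : p_polynomial p g ->
  g.[x + y] = g.[x] + g.[y].
Proof.
case=> n [b ->]; rewrite !horner_sum -big_split; apply: eq_bigr => i _.
by rewrite !hornerE /= exprD_exponent // mulrDr.
Qed.

(** The polynomial h = X^p + X^(p^2) + ... + X^(p^(r-1)). *)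
Definition frobenius_sum r : {poly F} := \sum_(1 <= i < r) 'X^(p ^ i).

Lemma deriv_frobenius_sum r : (frobenius_sum r)^`() = 0.
Proof.
have pFX : p \in [pchar {poly F}] by rewrite pchar_poly.
rewrite raddf_sum /= big_nat_cond big1 // => i /andP[/andP[i_gt0 _] _].
rewrite derivXn -(prednK i_gt0) expnS mulnC mulrnA -mulr_natr.
by rewrite pcharf0 // mulr0.
Qed.

Lemma frobenius_sumXp r : (0 < r)%N ->
  frobenius_sum r ^+ p - frobenius_sum r = 'X^(p ^ r) - 'X^p.
Proof.
move=> r_gt0; have pFX : p \in [pchar {poly F}] by rewrite pchar_poly.
rewrite -(pFrobenius_autE pFX) rmorph_sum -sumrB.
rewrite -[X in _ = _ - 'X^X]expn1.
rewrite -(telescope_sumr (fun i => 'X^(p ^ i) : {poly F})) //.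
by apply: eq_bigr => i _; rewrite /= pFrobenius_autE -exprM -expnSr.
Qed.

Lemma subst2_frobenius_sum r (x y : {poly {poly F}}) :
  subst2 (x + y) (frobenius_sum r) =
  subst2 x (frobenius_sum r) + subst2 y (frobenius_sum r).
Proof.
rewrite !rmorph_sum -big_split; apply: eq_bigr => i _.
by rewrite !rmorphXn /= !subst2X exprD_exponent // !pchar_poly.
Qed.

Lemma horner_frobenius_sum0 r : (frobenius_sum r).[0] = 0.
Proof.
rewrite horner_sum big1 // => i _.
have p_gt0 := prime_gt0 (pcharf_prime pF).
by rewrite hornerXn expr0n expn_eq0 (gtn_eqF p_gt0).
Qed.
End Frobenius.

(** * Generalized eigenspaces of D *)

Lemma exponent_root (F : fieldType) p n :
  (forall x : F, exists y, y ^+ p = x) -> forall x : F, exists y, y ^+ (p ^ n) = x.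
Proof.
move=> perfF; elim: n => [|n IH] x; first by exists x.
have [y <-] := IH x; have [z <-] := perfF y.
by exists z; rewrite -exprM -expnS.
Qed.

Section GeneralizedEigenspaces.
Variables (F : fieldType) (A : lmodType F) (D : {linear A -> A}) (p r : nat).
Hypothesis pF : p \in [pchar F].
Hypothesis diagD : diagonalizable_op (iter (p ^ r) D).
Let q := (p ^ r)%N.

Lemma iter_sub_scale n rho x :
  iter n (fun y => D y - rho *: y) x = poly_op (('X - rho%:P) ^+ n) D x.
Proof.
rewrite poly_op_exp; congr (iter n _ x).
by apply/funext => y; rewrite poly_opBl poly_opX poly_opC.
Qed.

Lemma XsubC_exponent (rho : F) :
  ('X - rho%:P) ^+ q = 'X^q - (rho ^+ q)%:P :> {poly F}.
Proof.
by rewrite exprB_exponent ?pchar_poly // rmorphXn.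
Qed.

(** The generalized eigenspaces of D are the eigenspaces of D^q, because
    (D - rho)^q = D^q - rho^q and D^q is diagonalizable. *)
Lemma gen_eigenspaceE rho :
  gen_eigenspace D rho = eigenspace_of (iter q D) (rho ^+ q).
Proof.
have opE y : poly_op ('X^q - (rho ^+ q)%:P) D y = iter q D y - rho ^+ q *: y.
  by rewrite poly_opBl poly_opXn poly_opC.
apply/seteqP; split=> x /=; last first.
  move=> xE; exists q; first by rewrite expn_gt0 prime_gt0 ?(pcharf_prime pF).
  by rewrite iter_sub_scale XsubC_exponent opE xE subrr.
case=> n n_gt0; rewrite iter_sub_scale => xn0.
have [_ Espan Eind] := (is_direct_sumP _).1 diagD.
have [s [f [s_uniq Ef xE]]] := Espan x.
suff fE c : c \in s -> iter q D (f c) = rho ^+ q *: f c.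
  rewrite /eigenspace_of /= xE linear_sum scaler_sumr !big_seq /=.
  by apply: eq_bigr.
have opf b : poly_op (('X^q - (rho ^+ q)%:P) ^+ n) D (f b) =
    (b - rho ^+ q) ^+ n *: f b.
  rewrite poly_op_exp; elim: (n) => [|k IH]; first by rewrite scale1r.
  rewrite iterS IH linearZ /= opE (Ef b) -scalerBl scalerA.
  by rewrite exprSr.
have : \sum_(c <- s) (c - rho ^+ q) ^+ n *: f c = 0.
  transitivity (poly_op (('X^q - (rho ^+ q)%:P) ^+ n) D x).
    by rewrite xE linear_sum; apply: eq_bigr => b _; rewrite /= opf.
  rewrite -XsubC_exponent -exprM mulnC exprM poly_op_exp.
  have q_gt0 : (0 < q)%N by rewrite expn_gt0 prime_gt0 ?(pcharf_prime pF).
  by rewrite -(prednK q_gt0) iterSr xn0; elim: q.-1 => //= k ->; rewrite linear0.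
move=> /(Eind s (fun b => (b - rho ^+ q) ^+ n *: f b) s_uniq) f0 cS.
have {}f0 : (c - rho ^+ q) ^+ n *: f c = 0.
  apply: f0 => // d; rewrite /eigenspace_of /= linearZ /= (Ef d).
  by rewrite !scalerA mulrC.
move/eqP: f0; rewrite scaler_eq0 expf_eq0 n_gt0 subr_eq0 /=.
by rewrite (Ef c) => /orP[/eqP->|/eqP->]; rewrite ?scaler0.
Qed.

Lemma gen_eigenspace_poly_op rho u x :
  gen_eigenspace D rho x -> gen_eigenspace D rho (poly_op u D x).
Proof.
rewrite !gen_eigenspaceE /eigenspace_of /= => xE.
by rewrite -poly_opXn poly_op_comm poly_opXn xE linearZ.
Qed.

Lemma gen_eigenspace_killed rho x :
  gen_eigenspace D rho x -> poly_op ('X^q - (rho ^+ q)%:P) D x = 0.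
Proof.
rewrite gen_eigenspaceE /eigenspace_of /= => xE.
by rewrite poly_opBl poly_opXn poly_opC xE subrr.
Qed.

Lemma gen_eigenspace_direct_sum :
  (forall x : F, exists y : F, y ^+ p = x) -> is_direct_sum (gen_eigenspace D).
Proof.
move=> perfF.
have [e eE] : exists e : F -> F, bijective e /\ forall x, e x = x ^+ q.
  exists (fun x => x ^+ q); split=> //.
  have /choice[e' e'E] := exponent_root r perfF.
  have inj : injective (fun x : F => x ^+ q).
    move=> x y /eqP; rewrite -subr_eq0 -exprB_exponent //.
    by rewrite expf_eq0 subr_eq0 => /andP[_ /eqP].
  by exists e' => x; [apply: inj|]; rewrite e'E.
have -> : gen_eigenspace D = eigenspace_of (iter q D) \o e.
  by apply/funext => rho; rewrite gen_eigenspaceE /= eE.2.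
by apply: direct_sum_reindex diagD; apply: eE.1.
Qed.

(** A polynomial annihilating D vanishes at every eigenvalue of D. *)
Lemma gen_eigenvalue_root (P : {poly F}) rho x :
  (forall y, poly_op P D y = 0) -> gen_eigenspace D rho x -> x != 0 -> P.[rho] = 0.
Proof.
move=> P0 [n _]; rewrite iter_sub_scale => xn0; apply: contra_neq_eq => Pr.
apply: (@poly_op_coprime0 _ _ D P (('X - rho%:P) ^+ n)) => //.
by rewrite coprimep_expr // coprimep_XsubC.
Qed.
End GeneralizedEigenspaces.

(** * The parameter of the Laguerre polynomial *)

Section LaguerreParameter.
Variables (F : fieldType) (p r : nat) (g : {poly F}).
Hypotheses (pF : p \in [pchar F]) (r_gt0 : (0 < r)%N) (gp : p_polynomial p g).
Let q := (p ^ r)%N.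

(** The parameter g(rho) - h(X). *)
Definition laguerre_param rho : {poly F} := g.[rho]%:P - frobenius_sum F p r.

Lemma deriv_laguerre_param rho : (laguerre_param rho)^`() = 0.
Proof. by rewrite derivB derivC deriv_frobenius_sum // subr0. Qed.

(** As h^p - h = X^q - X^p, the parameter is a solution alpha of the equation
    X^p = alpha^p - alpha modulo X^q - rho^q. *)
Lemma laguerre_paramXp rho : g.[rho] ^+ p - g.[rho] = rho ^+ q ->
  'X^p - (laguerre_param rho ^+ p - laguerre_param rho) = 'X^q - (rho ^+ q)%:P.
Proof.
move=> grho; have pFX : p \in [pchar {poly F}] by rewrite pchar_poly.
have expB (x y : {poly F}) : (x - y) ^+ p = x ^+ p - y ^+ p.
  by rewrite -!(pFrobenius_autE pFX) rmorphB.
rewrite /laguerre_param -grho expB polyCB rmorphXn /=.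
have -> : 'X^p = 'X^q - (frobenius_sum F p r ^+ p - frobenius_sum F p r).
  by rewrite frobenius_sumXp // opprB addrC subrK.
by ring.
Qed.

Lemma subst2_laguerre_param (x y : {poly {poly F}}) rho sigma :
  subst2 (x + y) (laguerre_param (rho + sigma)) =
  subst2 x (laguerre_param rho) + subst2 y (laguerre_param sigma).
Proof.
have sE z t : subst2 z (laguerre_param t) =
    g.[t]%:P%:P - subst2 z (frobenius_sum F p r).
  by rewrite /laguerre_param subst2B subst2C.
rewrite !sE subst2_frobenius_sum //.
by rewrite (p_polynomial_hornerD _ _ _ gp) // !polyCD; ring.
Qed.

(** At X = rho the parameter takes the value a = g(rho) - h(rho), which satisfies
    a^p - a = rho^p, and which is 0 if rho is. *)
Lemma laguerre_param_neq0 rho : g.[rho] ^+ p - g.[rho] = rho ^+ q ->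
  (laguerre_sub p (laguerre_param rho)).[rho] != 0.
Proof.
move=> grho; rewrite horner_laguerre_sub; apply: horner_laguerre_sub_neq0 => //.
  have := congr1 (fun u => u.[rho]) (laguerre_paramXp grho).
  rewrite !(hornerE, horner_exp) subrr => /eqP; rewrite subr_eq0 => /eqP ->.
  by [].
move=> ->; rewrite !hornerE horner_frobenius_sum0 // subr0.
apply: (addrI g.[0]); rewrite addr0 -(p_polynomial_hornerD _ _ _ gp) ?addr0 //.
Qed.

Lemma coprime_laguerre_param rho : g.[rho] ^+ p - g.[rho] = rho ^+ q ->
  coprimep (laguerre_sub p (laguerre_param rho)) ('X^q - (rho ^+ q)%:P).
Proof. by move=> grho; apply/coprimep_XnsubC_exponent/laguerre_param_neq0. Qed.
End LaguerreParameter.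

(** * Switching the grading *)

Section GradingSwitching.
Variables (p r : nat) (F : fieldType) (A : lmodType F) (D : {linear A -> A}).
Variable g : {poly F}.
Hypotheses (pF : p \in [pchar F]) (perfF : forall x : F, exists y, y ^+ p = x).
Hypotheses (r_gt0 : (0 < r)%N) (diagD : diagonalizable_op (iter (p ^ r) D)).
Hypothesis gp : p_polynomial p g.
Hypothesis gD : forall x : A,
  iter p (poly_op g D) x - poly_op g D x = iter (p ^ r) D x.
Let q := (p ^ r)%N.
Let ell rho := laguerre_sub p (laguerre_param p r g rho).

Lemma gen_eigenvalue_eq rho x : gen_eigenspace D rho x -> x != 0 ->
  g.[rho] ^+ p - g.[rho] = rho ^+ q.
Proof.
move=> Vx x_neq0.
have := @gen_eigenvalue_root _ _ D (g ^+ p - g - 'X^q) rho x.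
rewrite !(hornerE, horner_exp) => P0.
apply/eqP; rewrite -subr_eq0; apply/eqP/P0 => //.
by move=> y; rewrite !poly_opBl poly_op_exp poly_opXn gD subrr.
Qed.

Lemma laguerre_opE rho x :
  laguerre_op p.-1 (fun y => g.[rho] *: y - poly_op (frobenius_sum F p r) D y) D x =
  poly_op (ell rho) D x.
Proof.
have -> : (fun y => g.[rho] *: y - poly_op (frobenius_sum F p r) D y) =
    poly_op (laguerre_param p r g rho) D.
  by apply/funext => y; rewrite poly_opBl poly_opC.
by rewrite /laguerre_op poly2_opE laguerre_subE.
Qed.

Lemma laguerre_op_inj rho x : gen_eigenspace D rho x ->
  poly_op (ell rho) D x = 0 -> x = 0.
Proof.
move=> Vx Lx0; have [//|x_neq0] := eqVneq x 0.
apply: (poly_op_coprime0 _ Lx0 (gen_eigenspace_killed pF diagD Vx)).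
exact/coprime_laguerre_param/(gen_eigenvalue_eq Vx).
Qed.

Lemma laguerre_op_surj rho y : gen_eigenspace D rho y ->
  exists x, gen_eigenspace D rho x /\ poly_op (ell rho) D x = y.
Proof.
move=> Vy; have [y0|y_neq0] := eqVneq y 0.
  by exists y; split=> //; rewrite y0 linear0.
have /Bezout_eq1_coprimepP[[u v] /= uvE] :=
  coprime_laguerre_param pF r_gt0 gp (gen_eigenvalue_eq Vy y_neq0).
exists (poly_op u D y); split; first exact: (gen_eigenspace_poly_op pF diagD).
rewrite -[RHS]scale1r -(poly_opC D) polyC1 -uvE poly_opDl !poly_opM.
by rewrite (gen_eigenspace_killed pF diagD Vy) linear0 addr0 poly_op_comm.
Qed.

Variable LD : {linear A -> A}.
Hypothesis LDE : forall rho x,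
  gen_eigenspace D rho x -> LD x = poly_op (ell rho) D x.

(** The map preserves each generalized eigenspace and is invertible on it, the
    Laguerre polynomial being coprime to X^q - rho^q. *)
Lemma laguerre_map_inj : injective LD.
Proof.
have /is_direct_sumP[Vsub Vspan Vind] := gen_eigenspace_direct_sum pF diagD perfF.
suff ker0 x : LD x = 0 -> x = 0.
  move=> x y xy; apply/eqP; rewrite -subr_eq0; apply/eqP/ker0.
  by rewrite linearB /= xy subrr.
have [s [f [s_uniq Vf ->]]] := Vspan x; rewrite linear_sum /= => sum0.
rewrite big_seq big1 // => rho rhoS; apply: laguerre_op_inj (Vf rho) _.
apply: (Vind s (fun rho => poly_op (ell rho) D (f rho))) => //.
  by move=> c; apply: (gen_eigenspace_poly_op pF diagD).
by rewrite -[RHS]sum0; apply: eq_bigr => c _; rewrite (LDE (Vf c)).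
Qed.

Lemma laguerre_map_surj y : exists x, LD x = y.
Proof.
have /is_direct_sumP[Vsub Vspan Vind] := gen_eigenspace_direct_sum pF diagD perfF.
have [s [f [s_uniq Vf ->]]] := Vspan y.
have /choice[f' f'E] : forall rho, exists x,
    gen_eigenspace D rho x /\ poly_op (ell rho) D x = f rho.
  by move=> rho; apply: laguerre_op_surj.
exists (\sum_(rho <- s) f' rho); rewrite linear_sum /=; apply: eq_bigr => c _.
by have [Vc <-] := f'E c; rewrite (LDE Vc).
Qed.

Variables (m : nat) (mul : {bilinear A -> A -> A}) (G : 'I_m -> set A) (d : int).
Hypotheses (m_gt0 : (0 < m)%N) (derD : is_derivation mul D).
Hypotheses (gradG : is_grading mul G) (degD : graded_of_degree G d D).
Hypothesis pd0 : (m %| p%:Z * d)%Z.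

(** The class of an integer modulo m, as an element of 'I_m. *)
Definition residue (z : int) : 'I_m := Ordinal (ltn_pmod `|(z %% m)%Z|%N m_gt0).

Lemma residueE z : ((residue z : nat)%:Z = z %[mod m])%Z.
Proof.
rewrite /residue /= -modz_nat modz_mod gez0_abs ?modz_mod //.
by rewrite modz_ge0 // -lt0n.
Qed.

Lemma iter_degree n (i j : 'I_m) x :
  (j%:Z = i%:Z + n%:Z * d %[mod m])%Z -> G i x -> G j (iter n D x).
Proof.
elim: n j => [|n IH] j jE Gx.
  by move: jE; rewrite mul0r addr0 !modz_nat !modn_small // => -[/val_inj ->].
rewrite iterS; apply: (degD (i := residue (i%:Z + n%:Z * d))); last first.
  by apply: IH => //; apply: residueE.
rewrite jE -[in RHS]modzDml residueE modzDml -addrA; congr ((_ + _) %% _)%Z.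
by rewrite intS; ring.
Qed.

(** The hypothesis that m divides p d makes monomials of total degree divisible
    by p compatible with the grading. *)
Lemma monomial_degree a b (i j k : 'I_m) x y : (p %| a + b)%N ->
  (k = i + j %[mod m])%N -> G i x -> G j y -> G k (mul (iter a D x) (iter b D y)).
Proof.
move=> p_ab kE Gx Gy; have [_ GM] := gradG.
apply: (GM (residue (i%:Z + a%:Z * d)) (residue (j%:Z + b%:Z * d))).
- apply/eqP; rewrite -eqz_nat -!modz_nat PoszD -modzDm !residueE modzDm.
  rewrite modz_nat kE -modz_nat PoszD addrACA -mulrDl.
  have /dvdnP[c cE] := p_ab.
  have /dvdzP[e eE] := pd0.
  by rewrite -[(a%:Z + b%:Z)]PoszD cE PoszM -mulrA eE mulrA addrC modzMDl.
- by apply: iter_degree Gx; apply: residueE.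
- by apply: iter_degree Gy; apply: residueE.
Qed.

(** The product of LD x and LD y is the image under LD of C acting on the product
    of x and y, where C is the factor in laguerre_sub_switch. *)
Lemma laguerre_map_mul rho sigma (i j k : 'I_m) x y :
  (k = i + j %[mod m])%N ->
  gen_eigenspace D rho x -> gen_eigenspace D sigma y -> G i x -> G j y ->
  exists2 z, G k z & LD z = mul (LD x) (LD y).
Proof.
move=> kE Vx Vy Gx Gy; have [[Gsub _] _] := gradG.
have G0 : G k 0 by have /submod_closedP[] := Gsub k.
have [->|x_neq0] := eqVneq x 0; first by exists 0; rewrite ?linear0 ?linear0l.
have [->|y_neq0] := eqVneq y 0; first by exists 0; rewrite ?linear0 ?linear0r.
have gr := gen_eigenvalue_eq Vx x_neq0; have gs := gen_eigenvalue_eq Vy y_neq0.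
have gt : g.[rho + sigma] ^+ p - g.[rho + sigma] = (rho + sigma) ^+ q.
  rewrite (p_polynomial_hornerD _ _ _ gp) // exprD_exponent // -gr -gs.
  have -> : (g.[rho] + g.[sigma]) ^+ p = g.[rho] ^+ p + g.[sigma] ^+ p.
    by rewrite -!(pFrobenius_autE pF) rmorphD.
  by ring.
have [C [P1 [P2 [CE C_deg]]]] := laguerre_sub_switch pF r_gt0
  (deriv_laguerre_param r g pF rho) (deriv_laguerre_param r g pF sigma)
  (deriv_laguerre_param r g pF (rho + sigma))
  (laguerre_paramXp pF r_gt0 gr) (laguerre_paramXp pF r_gt0 gs)
  (laguerre_paramXp pF r_gt0 gt)
  (subst2_laguerre_param _ pF gp _ _ _ _) (laguerre_param_neq0 pF r_gt0 gp gt).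
have kill1 P : poly2_mul mul D (P * subst2 'X%:P ('X^q - (rho ^+ q)%:P)) x y = 0.
  by rewrite mulrC poly2_mul_substl (gen_eigenspace_killed pF diagD Vx) poly2_mul0l.
have kill2 P : poly2_mul mul D (P * subst2 'X ('X^q - (sigma ^+ q)%:P)) x y = 0.
  by rewrite mulrC poly2_mul_substr (gen_eigenspace_killed pF diagD Vy) linear0.
exists (poly2_mul mul D C x y).
  by apply: poly2_mul_mem => // a b /C_deg p_ab; apply: monomial_degree Gx Gy.
(* X^q + Y^q - (rho + sigma)^q lies in the ideal annihilating (x, y). *)
have Vz : gen_eigenspace D (rho + sigma) (poly2_mul mul D C x y).
  rewrite (gen_eigenspaceE pF diagD) /eigenspace_of /=.
  apply/eqP; rewrite -subr_eq0.
  rewrite -poly_opXn -(poly_opC D) -poly_opBl -poly2_mul_substD // subst2_fD //.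
  by rewrite mulrDl poly2_mulDl ![_ * C]mulrC kill1 kill2 addr0.
rewrite (LDE Vx) (LDE Vy) (LDE Vz) -poly2_mul_substD //.
transitivity (poly2_mul mul D (subst2 'X%:P (ell rho) * subst2 'X (ell sigma)) x y).
  by rewrite CE !poly2_mulDl kill1 kill2 !addr0.
by rewrite poly2_mul_substl -[subst2 'X _]mulr1 poly2_mul_substr poly2_mul1.
Qed.

Lemma laguerre_map_grading : is_grading mul (fun k => LD @` G k).
Proof.
have [dirG _] := gradG; split.
  exact: direct_sum_image laguerre_map_inj laguerre_map_surj dirG.
have /is_direct_sumP[LGsub _ _] :=
  direct_sum_image laguerre_map_inj laguerre_map_surj dirG.
(* D^q preserves the grading: its degree q d is divisible by m since r > 0. *)
have GDq l z : G l z -> G l (iter q D z).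
  apply: iter_degree; apply/eqP; rewrite eqz_mod_dvd opprD addrA subrr add0r rpredN.
  rewrite /q -(prednK r_gt0) expnS PoszM mulrAC; exact: dvdz_mulr.
have homog l z : G l z -> exists (s : seq F) (f : F -> A),
    (forall c, (exists rho, gen_eigenspace D rho (f c)) /\ G l (f c)) /\
    z = \sum_(c <- s) f c.
  move=> Gz; have [s [f [fE zE]]] := eigenvectors_homogeneous dirG GDq diagD Gz.
  exists s, f; split=> // c; have [Ec Gc] := fE c; split=> //.
  have [rho rhoE] := exponent_root r perfF c.
  by exists rho; rewrite (gen_eigenspaceE pF diagD) rhoE.
move=> i j k kE _ _ [x Gx <-] [y Gy <-].
have [s [f [fE ->]]] := homog _ _ Gx; have [t [h [hE ->]]] := homog _ _ Gy.
rewrite !(linear_sum LD) /= linear_sumlz; apply: (submod_sum _ (LGsub k)) => b.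
rewrite linear_sumr; apply: (submod_sum _ (LGsub k)) => c.
have [[rho Vb] Gb] := fE b; have [[sigma Vc] Gc] := hE c.
by have [z Gz <-] := laguerre_map_mul kE Vb Vc Gb Gc; exists z.
Qed.

End GradingSwitching.

Theorem theorem5p1 (p : nat) (F : fieldType) (m : nat) (A : lmodType F)
    (mul : {bilinear A -> A -> A}) (G : 'I_m -> set A)
    (D : {linear A -> A}) (d : int) (r : nat) (g : {poly F}) :
  prime p -> perfect_of_char p F -> (0 < m)%N ->
  is_grading mul G ->
  is_derivation mul D -> graded_of_degree G d D ->
  (m %| p%:Z * d)%Z ->
  (1 <= r)%N -> diagonalizable_op (iter (p ^ r) D) ->
  p_polynomial p g ->
  (forall x : A, iter p (poly_op g D) x - poly_op g D x = iter (p ^ r) D x) ->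
  let h : {poly F} := \sum_(1 <= i < r) 'X^(p ^ i) in
  let is_LD (LD : {linear A -> A}) :=
    forall (rho : F) (x : A), gen_eigenspace D rho x ->
      LD x =
      laguerre_op p.-1 (fun y => g.[rho] *: y - poly_op h D y) D x in
  is_direct_sum (gen_eigenspace D) /\
  (exists LD : {linear A -> A}, is_LD LD) /\
  (forall LD : {linear A -> A}, is_LD LD ->
     is_grading mul (fun k => LD @` G k)).
Proof.
move=> _ [pF perfF] m_gt0 gradG derD degD pd0 r_gt0 diagD gp gD h is_LD.
have dirV := gen_eigenspace_direct_sum pF diagD perfF.
have opE rho x := laguerre_opE (p := p) r D g pF rho x.
split=> //; split.
  have [LD LDE] := direct_sum_extend
    (fun rho =>
       poly_op (laguerre_sub p (laguerre_param p r g rho)) D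
       : {linear A -> A}) dirV.
  by exists LD => rho x Vx; rewrite opE; apply: LDE.
move=> LD LDE.
apply: (@laguerre_map_grading p r F A D g
  pF perfF r_gt0 diagD gp gD LD _ m mul G d) => //.
by move=> rho x Vx; rewrite (LDE rho) // opE.
Qed.
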